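(* Let $d\in\mathbb{R}$, and consider the complex system $$\frac{dz}{dT}=z+\sum_{k+j+l\ge 2}a_{kjl}z^kw^ju^l=Z(z,w,u),\qquad \frac{dw}{dT}=-w-\sum_{k+j+l\ge 2}b_{kjl}w^kz^ju^l=-W(z,w,u),$$ $$\frac{du}{dT}=\mathbf{i}\,d\,u+\sum_{k+j+l\ge 2}d_{kjl}z^kw^ju^l=U(z,w,u),$$ with $a_{kjl},b_{kjl},d_{kjl}\in\mathbb{C}$ ($k,j,l$ nonnegative integers). When taking $c_{100}=1$, $c_{001}=c_{010}=0$, and $c_{k+1,k,0}=0$ for $k=1,2,\dots$, one can derive successively and uniquely the terms of a formal series $$f(z,w,u)=z+\sum_{\alpha+\beta+\gamma=2}^{\infty}c_{\alpha\beta\gamma}z^{\alpha}w^{\beta}u^{\gamma}$$ such that $$\frac{df}{dT}-f=\frac{\partial f}{\partial z}Z-\frac{\partial f}{\partial w}W+\frac{\partial f}{\partial u}U-f=z\cdot\sum_{m=1}^{\infty}p'_m(zw)^m ,$$ and, for $\alpha+\beta+\gamma\ge 2$, if $\alpha\neq\beta+1$, or $\alpha=\beta+1$ and $\gamma\neq 0$, then $c_{\alpha\beta\gamma}$ is determined by the recursive formula $$c_{\alpha\beta\gamma}=\frac{1}{1+\beta-\alpha-\mathbf{i}d\gamma}\sum_{k+j+l=3}^{\alpha+\beta+\gamma+2}\big[(\alpha-k+1)a_{k,j-1,l}-(\beta-j+1)b_{j,k-1,l}+(\gamma-l)d_{k-1,j-1,l+1}\big]\,c_{\alpha-k+1,\beta-j+1,\gamma-l},$$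 and for every positive integer $m$, $p'_m$ is determined by the recursive formula $$p'_m=\sum_{k+j+l=3}^{2m+3}\big[(m-k+2)a_{k,j-1,l}-(m-j+1)b_{j,k-1,l}-l\,d_{k-1,j-1,l+1}\big]\,c_{m-k+2,m-j+1,-l}.$$
   Context: $\mathbf{i}=\sqrt{-1}$. All series are treated as formal power series. Conventions for the formulas: $c_{\alpha\beta\gamma}=0$ whenever $\alpha<0$ or $\beta<0$ or $\gamma<0$, or when $\gamma=0$ and $\alpha=\beta+1$ with $(\alpha,\beta,\gamma)\ne(1,0,0)$, while $c_{100}=1$; also $c_{000}=0$ since $f$ has no constant term. The sum $\sum_{k+j+l=3}^{N}$ runs over all integers $k,j\ge 0$, $l\ge -1$ with $3\le k+j+l\le N$, and any coefficient $a$, $b$ or $d$ having a negative index is taken to be $0$. (The system above arises from a real system $\dot x=-y+\cdots$, $\dot y=x+\cdots$, $\dot u=-du+\cdots$ by $z=x+\mathbf{i}y$, $w=x-\mathbf{i}y$, $t=-T\mathbf{i}$.)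
   Formalization: The formal theorem assumes d ≠ 0; for d = 0 the denominator 1+β−α−idγ vanishes when α=β+1, γ≠0, and existence fails, e.g. for dz/dT = z+zu, dw/dT = −w, du/dT = 0. *)

(* Defs.v *)
From mathcomp Require Import all_boot all_order all_algebra.
From mathcomp Require Import reals.
From mathcomp.real_closed Require Import complex.

Set Implicit Arguments.
Unset Strict Implicit.
Unset Printing Implicit Defensive.

Import Order.TTheory GRing.Theory Num.Theory.
Local Open Scope ring_scope.

(* A formal power series in z, w, u is the family of its coefficients:
   [f i j k] is the coefficient of z^i w^j u^k. *)
Definition fps3 (K : Type) : Type := nat -> nat -> nat -> K.

Declare Scope fps_scope.
Delimit Scope fps_scope with FPS.
Bind Scope fps_scope with fps3.

Section FormalSeries.
Variable K : nzRingType.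
Implicit Types (f g : fps3 K) (i j k : nat).

Definition fps_monomial i0 j0 k0 : fps3 K :=
  fun i j k => if [&& i == i0, j == j0 & k == k0] then 1 else 0.
Definition fps_z : fps3 K := fps_monomial 1 0 0.
Definition fps_w : fps3 K := fps_monomial 0 1 0.
Definition fps_u : fps3 K := fps_monomial 0 0 1.

Definition fps_add f g : fps3 K := fun i j k => f i j k + g i j k.
Definition fps_opp f : fps3 K := fun i j k => - f i j k.
Definition fps_scale (x : K) f : fps3 K := fun i j k => x * f i j k.
Definition fps_mul f g : fps3 K := fun i j k =>
  \sum_(i1 < i.+1) \sum_(j1 < j.+1) \sum_(k1 < k.+1)
     f i1 j1 k1 * g (i - i1)%N (j - j1)%N (k - k1)%N.

Definition fps_dz f : fps3 K := fun i j k => i.+1%:R * f i.+1 j k.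
Definition fps_dw f : fps3 K := fun i j k => j.+1%:R * f i j.+1 k.
Definition fps_du f : fps3 K := fun i j k => k.+1%:R * f i j k.+1.

(* The series whose terms of total degree >= 2 are those of f. *)
Definition fps_ge2 f : fps3 K :=
  fun i j k => if (2 <= i + j + k)%N then f i j k else 0.

(* \sum_(m >= 1) p m (zw)^m *)
Definition fps_zw (p : nat -> K) : fps3 K := fun i j k =>
  if [&& (1 <= i)%N, j == i & k == 0%N] then p i else 0.

(* Coefficients with integer indices, 0 if some index is negative. *)
Definition fps_coefz f (i j k : int) : K :=
  match i, j, k with
  | Posz i', Posz j', Posz k' => f i' j' k'
  | _, _, _ => 0
  end.

(* The sum of F k j l over the integers k, j >= 0 and l >= -1 such that
   3 <= k + j + l <= N. The third bound variable is l + 1; the constraint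
   forces k, j, l + 1 <= N + 1. *)
Definition sum3 (N : nat) (F : int -> int -> int -> K) : K :=
  \sum_(k < N.+2) \sum_(j < N.+2)
    \sum_(l1 < N.+2 | (3 <= k%:Z + j%:Z + (l1%:Z - 1) <= N%:Z))
      F k%:Z j%:Z (l1%:Z - 1).

End FormalSeries.

Arguments fps_monomial {K} i0 j0 k0 _ _ _.
Arguments fps_z {K} _ _ _.
Arguments fps_w {K} _ _ _.
Arguments fps_u {K} _ _ _.

Notation "f + g" := (fps_add f g) : fps_scope.
Notation "- f" := (fps_opp f) : fps_scope.
Notation "f - g" := (fps_add f (fps_opp g)) : fps_scope.
Notation "f * g" := (fps_mul f g) : fps_scope.
Notation "x *: f" := (fps_scale x f) : fps_scope.

Section System.
Variable R : realType.
Implicit Types (a b e : fps3 R[i]) (f : fps3 R[i]) (d : R).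

(* dz/dT = Z, dw/dT = - W, du/dT = U. Only the values of a, b, e at indices of
   sum >= 2 matter. *)
Definition fieldZ a : fps3 R[i] := (fps_z + fps_ge2 a)%FPS.

(* [b k j l] is the coefficient of w^k z^j u^l. *)
Definition fieldW b : fps3 R[i] :=
  (fps_w + fps_ge2 (fun i j l => b j i l))%FPS.

Definition fieldU d e : fps3 R[i] :=
  (('i%C * d%:C%C) *: fps_u + fps_ge2 e)%FPS.

(* df/dT along the system *)
Definition derivT a b d e f : fps3 R[i] :=
  (fps_dz f * fieldZ a - fps_dw f * fieldW b + fps_du f * fieldU d e)%FPS.

(* f = z + (terms of degree >= 2), with c_{k+1,k,0} = 0 for k >= 1 *)
Definition normalized f : Prop :=
  [/\ f 0%N 0%N 0%N = 0, f 1%N 0%N 0%N = 1, f 0%N 1%N 0%N = 0,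
      f 0%N 0%N 1%N = 0
    & forall k : nat, (1 <= k)%N -> f k.+1 k 0%N = 0].

(* The value p 0 is irrelevant. *)
Definition is_solution a b d e f (p : nat -> R[i]) : Prop :=
  normalized f /\
  forall i j k : nat,
    (derivT a b d e f - f)%FPS i j k = (fps_z * fps_zw p)%FPS i j k.

End System.

(* Main.v *)
(** Comparing coefficients of z^i w^j u^k in df/dT - f, the linear part of the
    system acts diagonally, with eigenvalue - (1 + j - i - 'i d k), while the
    terms of degree >= 2 contribute an expression which only involves the
    coefficients of f of degree < i + j + k. Since d is a nonzero real, the
    eigenvalue vanishes exactly at the resonant indices i = j + 1, k = 0. At the
    other indices the equation can be solved for c_{ijk}; at the resonant ones
    c_{ijk} is prescribed and the equation gives p_j. *)
Require Import Defs.
From mathcomp Require Import all_boot all_order all_algebra.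
From mathcomp Require Import zify ring.
From mathcomp Require Import reals.
From mathcomp.real_closed Require Import complex.

Set Implicit Arguments.
Unset Strict Implicit.
Unset Printing Implicit Defensive.

Import Order.TTheory GRing.Theory Num.Theory.
Local Open Scope ring_scope.

(** * Products of formal power series *)

Section SeriesLemmas.
Variable K : comNzRingType.
Implicit Types (f g h : fps3 K) (i j k : nat).

Lemma fps_mulC f g i j k : (f * g)%FPS i j k = (g * f)%FPS i j k.
Proof.
rewrite /fps_mul (reindex_inj rev_ord_inj); apply: eq_bigr => i1 _.
rewrite (reindex_inj rev_ord_inj); apply: eq_bigr => j1 _.
rewrite (reindex_inj rev_ord_inj); apply: eq_bigr => k1 _ /=.
by rewrite !subSS !subKn -1?ltnS // mulrC.
Qed.

Lemma fps_mulDr f g h i j k :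
  (f * (g + h))%FPS i j k = (f * g)%FPS i j k + (f * h)%FPS i j k.
Proof.
rewrite /fps_mul -big_split; apply: eq_bigr => i1 _ /=.
rewrite -big_split; apply: eq_bigr => j1 _ /=.
by rewrite -big_split; apply: eq_bigr => k1 _ /=; rewrite mulrDr.
Qed.

Lemma fps_mulZr x f g i j k :
  (f * (x *: g))%FPS i j k = x * (f * g)%FPS i j k.
Proof.
rewrite /fps_mul mulr_sumr; apply: eq_bigr => i1 _.
rewrite mulr_sumr; apply: eq_bigr => j1 _.
by rewrite mulr_sumr; apply: eq_bigr => k1 _; rewrite mulrCA.
Qed.

Lemma fps_monomial_mul i0 j0 k0 f i j k :
  (fps_monomial i0 j0 k0 * f)%FPS i j k =
  if [&& (i0 <= i)%N, (j0 <= j)%N & (k0 <= k)%N]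
  then f (i - i0)%N (j - j0)%N (k - k0)%N else 0.
Proof.
(* The monomial is a Kronecker delta, so each sum keeps a single index; the test in the statement
   says whether that index lies in the range. *)
transitivity (\sum_(i1 < i.+1 | i1 == i0 :> nat)
  \sum_(j1 < j.+1 | j1 == j0 :> nat) \sum_(k1 < k.+1 | k1 == k0 :> nat)
    f (i - i1)%N (j - j1)%N (k - k1)%N).
  rewrite [RHS]big_mkcond; apply: eq_bigr => i1 _.
  case: eqP => [Ei|/eqP/negPf Ei].
    rewrite [RHS]big_mkcond; apply: eq_bigr => j1 _.
    case: eqP => [Ej|/eqP/negPf Ej].
      rewrite [RHS]big_mkcond; apply: eq_bigr => k1 _.
      rewrite /fps_monomial Ei Ej !eqxx /=.
      by case: eqP => _; rewrite ?mul1r ?mul0r.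
    by apply: big1 => k1 _; rewrite /fps_monomial Ej andbF mul0r.
  by apply: big1 => j1 _; apply: big1 => k1 _; rewrite /fps_monomial Ei mul0r.
rewrite (big_ord1_eq _ (fun i1 => \sum_(j1 < j.+1 | j1 == j0 :> nat)
  \sum_(k1 < k.+1 | k1 == k0 :> nat) f (i - i1)%N (j - j1)%N (k - k1)%N)).
rewrite ltnS; case: ifP => //= _.
rewrite (big_ord1_eq _ (fun j1 =>
  \sum_(k1 < k.+1 | k1 == k0 :> nat) f (i - i0)%N (j - j1)%N (k - k1)%N)).
rewrite ltnS; case: ifP => //= _.
by rewrite (big_ord1_eq _ (fun k1 => f (i - i0)%N (j - j0)%N (k - k1)%N)) ltnS.
Qed.

(** Euler operator: monomials are its eigenvectors. This and its analogues in w and u make the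
    linear part of the system diagonal. *)
Lemma fps_dz_mul_z f i j k : (fps_dz f * fps_z)%FPS i j k = i%:R * f i j k.
Proof.
rewrite fps_mulC fps_monomial_mul /= !subn0 andbT.
by case: i => [|i] /=; rewrite ?mul0r // /fps_dz subn1.
Qed.

Lemma fps_dw_mul_w f i j k : (fps_dw f * fps_w)%FPS i j k = j%:R * f i j k.
Proof.
rewrite fps_mulC fps_monomial_mul /= !subn0 andbT.
by case: j => [|j] /=; rewrite ?mul0r // /fps_dw subn1.
Qed.

Lemma fps_du_mul_u f i j k : (fps_du f * fps_u)%FPS i j k = k%:R * f i j k.
Proof.
rewrite fps_mulC fps_monomial_mul /= !subn0.
by case: k => [|k] /=; rewrite ?mul0r // /fps_du subn1.
Qed.

(** The second factor has order at least 2, so it uses up at least two units of the total degree and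
    leaves the rest to the first factor. *)
Lemma fps_mul_ge2_local f g h i j k :
    (forall i' j' k', (i' + j' + k' + 2 <= i + j + k)%N ->
      f i' j' k' = g i' j' k') ->
  (f * fps_ge2 h)%FPS i j k = (g * fps_ge2 h)%FPS i j k.
Proof.
move=> fg; apply: eq_bigr => i1 _; apply: eq_bigr => j1 _.
apply: eq_bigr => k1 _; rewrite /fps_ge2.
have := ltn_ord i1; have := ltn_ord j1; have := ltn_ord k1.
case: ifP => [h2|]; last by rewrite !mulr0.
by move=> *; rewrite fg //; lia.
Qed.

Lemma fps_mul_ge2_low f h i j k :
  (i + j + k < 2)%N -> (f * fps_ge2 h)%FPS i j k = 0.
Proof.
move=> lt2; apply: big1 => i1 _; apply: big1 => j1 _; apply: big1 => k1 _.
by rewrite /fps_ge2; case: ifP => [|_]; [lia | rewrite mulr0].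
Qed.

(** * Integer-indexed triple sums as Cauchy products *)

Lemma fps_coefz_neg f (i j k : int) :
  [|| i < 0, j < 0 | k < 0] -> fps_coefz f i j k = 0.
Proof. by case: i => i; case: j => j; case: k => k. Qed.

(** Trims the uniform range of a variable of [sum3] to the support of the summand, then moves that
    support to the origin, as a Cauchy product requires. *)
Lemma sum_ord_shift (V : nmodType) (s n m : nat) (G : nat -> V) :
    (n + s <= m)%N -> (forall k, (k < s)%N || (n + s <= k)%N -> G k = 0) ->
  \sum_(k < m) G k = \sum_(k < n) G (k + s)%N.
Proof.
move=> le_m G0; rewrite -(big_mkord xpredT G) (big_cat_nat (n := n + s)) //=.
rewrite [X in _ + X]big_nat_cond [X in _ + X]big1 ?addr0; last first.
  by move=> k /andP[/andP[nk _] _]; rewrite G0 // nk orbT.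
rewrite (big_cat_nat (n := s)) //= ?leq_addl //.
rewrite big_nat_cond big1 ?add0r; last first.
  by move=> k /andP[/andP[_ ks] _]; rewrite G0 // ks.
by rewrite -{1}[s]add0n big_addn addnK big_mkord.
Qed.

Lemma sum_ord_shift3 (V : nmodType) (s1 s2 s3 n1 n2 n3 m : nat)
    (G : nat -> nat -> nat -> V) :
    (n1 + s1 <= m)%N -> (n2 + s2 <= m)%N -> (n3 + s3 <= m)%N ->
    (forall k j l, [|| (k < s1)%N, (n1 + s1 <= k)%N, (j < s2)%N,
       (n2 + s2 <= j)%N, (l < s3)%N | (n3 + s3 <= l)%N] -> G k j l = 0) ->
  \sum_(k < m) \sum_(j < m) \sum_(l < m) G k j l =
  \sum_(k < n1) \sum_(j < n2) \sum_(l < n3)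
    G (k + s1)%N (j + s2)%N (l + s3)%N.
Proof.
move=> le1 le2 le3 G0.
rewrite (@sum_ord_shift _ s1 n1 m
  (fun k => \sum_(j < m) \sum_(l < m) G k j l)) //; last first.
  by move=> k hk; apply: big1 => j _; apply: big1 => l _; apply: G0; lia.
apply: eq_bigr => k _.
rewrite (@sum_ord_shift _ s2 n2 m (fun j => \sum_(l < m) G (k + s1)%N j l)) //;
  last by move=> j hj; apply: big1 => l _; apply: G0; lia.
apply: eq_bigr => j _; rewrite (@sum_ord_shift _ s3 n3 m (G _ _)) // => l hl.
by apply: G0; lia.
Qed.

Lemma eq_sum3 N (F G : int -> int -> int -> K) :
  (forall k j l : int, F k j l = G k j l) -> sum3 N F = sum3 N G.
Proof.
move=> FG; apply: eq_bigr => k _; apply: eq_bigr => j _.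
by apply: eq_bigr => l _; apply: FG.
Qed.

Lemma sum3D N (F G : int -> int -> int -> K) :
  sum3 N (fun k j l : int => F k j l + G k j l) = sum3 N F + sum3 N G.
Proof.
rewrite /sum3 -big_split; apply: eq_bigr => k _ /=.
by rewrite -big_split; apply: eq_bigr => j _ /=; rewrite -big_split.
Qed.

Lemma sum3N N (F : int -> int -> int -> K) :
  sum3 N (fun k j l : int => - F k j l) = - sum3 N F.
Proof.
rewrite /sum3 -sumrN; apply: eq_bigr => k _.
by rewrite -sumrN; apply: eq_bigr => j _; rewrite -sumrN.
Qed.

(** The shifts absorb the offsets in the indices of [g]. Since [sum3] is indexed by l + 1, the third
    shift is relative to l + 1, not to l. *)
Lemma sum3_shift (s1 s2 s3 N i j k : nat) (F : int -> int -> int -> K)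
    (f g : fps3 K) :
    (i + s1 <= N.+1)%N -> (j + s2 <= N.+1)%N -> (k + s3 <= N.+1)%N ->
    (forall x y z : nat, [|| (x < s1)%N, (i + s1 < x)%N, (y < s2)%N,
       (j + s2 < y)%N, (z < s3)%N | (k + s3 < z)%N] ->
       F x%:Z y%:Z (z%:Z - 1) = 0) ->
    (forall x y z : nat, (x <= i)%N -> (y <= j)%N -> (z <= k)%N ->
       (if (3 <= (x + s1)%:Z + (y + s2)%:Z + ((z + s3)%:Z - 1) <= N%:Z)
        then F (x + s1)%:Z (y + s2)%:Z ((z + s3)%:Z - 1) else 0) =
       g x y z * f (i - x)%N (j - y)%N (k - z)%N) ->
  sum3 N F = (f * g)%FPS i j k.
Proof.
move=> le1 le2 le3 F0 Fg; rewrite fps_mulC /sum3.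
under eq_bigr => x _ do under eq_bigr => y _ do rewrite big_mkcond /=.
rewrite (@sum_ord_shift3 _ s1 s2 s3 i.+1 j.+1 k.+1 N.+2 (fun x y z : nat =>
  if (3 <= x%:Z + y%:Z + (z%:Z - 1) <= N%:Z) then F x%:Z y%:Z (z%:Z - 1)
  else 0)) ?addSn //; last first.
  by move=> x y z out; rewrite F0 ?if_same.
apply: eq_bigr => x _; apply: eq_bigr => y _; apply: eq_bigr => z _.
by apply: Fg; rewrite -ltnS.
Qed.

(** The coefficient of [g] has second index y - 1 and the third bound variable is l + 1, whence the
    shifts 0, 1, 1. Outside the product range, an index is negative or the factor from
    differentiation is zero. *)
Lemma sum3_dz f g (i j k : nat) :
  sum3 (i + j + k + 2) (fun x y z : int =>
    (i%:Z - x + 1)%:~R * fps_coefz g x (y - 1) z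
    * fps_coefz f (i%:Z - x + 1) (j%:Z - y + 1) (k%:Z - z)) =
  (fps_dz f * fps_ge2 g)%FPS i j k.
Proof.
apply: (@sum3_shift 0 1 1); try lia.
  (* At x = i + 1 the index of [f] is 0, not negative: here it is the factor i - x + 1 that kills
     the term. *)
  move=> x y z out; case: (eqVneq x i.+1) => [->|ne].
    by rewrite (_ : i%:Z - _ + 1 = 0) ?mul0r //; lia.
  case: (boolP ((y < 1) || (z < 1))%N) => yz.
    by rewrite (@fps_coefz_neg g) ?mulr0 ?mul0r //; lia.
  by rewrite (@fps_coefz_neg f) ?mulr0 //; lia.
move=> x y z xi yj zk; rewrite /fps_ge2 /fps_dz.
(* After the shifts the constrained sum is x + y + z + 1: the lower bound 3 becomes the order
   condition of [fps_ge2], and the upper bound always holds. *)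
rewrite (_ : (3 <= _ <= _) = (2 <= x + y + z)%N); last by lia.
case: ifP => _; last by rewrite mul0r.
rewrite (_ : i%:Z - _ + 1 = (i - x).+1%:Z); last by lia.
rewrite (_ : j%:Z - _ + 1 = (j - y)%N%:Z); last by lia.
rewrite (_ : k%:Z - _ = (k - z)%N%:Z); last by lia.
rewrite (_ : (y + 1)%N%:Z - 1 = y%:Z); last by lia.
rewrite (_ : (z + 1)%N%:Z - 1 = z%:Z); last by lia.
by rewrite addn0 /= mulrA -pmulrn [_ * g _ _ _]mulrC.
Qed.

Lemma sum3_dw f g (i j k : nat) :
  sum3 (i + j + k + 2) (fun x y z : int =>
    (j%:Z - y + 1)%:~R * fps_coefz g y (x - 1) z
    * fps_coefz f (i%:Z - x + 1) (j%:Z - y + 1) (k%:Z - z)) =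
  (fps_dw f * fps_ge2 (fun i j k => g j i k))%FPS i j k.
Proof.
apply: (@sum3_shift 1 0 1); try lia.
  move=> x y z out; case: (eqVneq y j.+1) => [->|ne].
    by rewrite (_ : j%:Z - _ + 1 = 0) ?mul0r //; lia.
  case: (boolP ((x < 1) || (z < 1))%N) => yz.
    by rewrite (@fps_coefz_neg g) ?mulr0 ?mul0r //; lia.
  by rewrite (@fps_coefz_neg f) ?mulr0 //; lia.
move=> x y z xi yj zk; rewrite /fps_ge2 /fps_dw.
rewrite (_ : (3 <= _ <= _) = (2 <= x + y + z)%N); last by lia.
case: ifP => _; last by rewrite mul0r.
rewrite (_ : j%:Z - _ + 1 = (j - y).+1%:Z); last by lia.
rewrite (_ : i%:Z - _ + 1 = (i - x)%N%:Z); last by lia.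
rewrite (_ : k%:Z - _ = (k - z)%N%:Z); last by lia.
rewrite (_ : (x + 1)%N%:Z - 1 = x%:Z); last by lia.
rewrite (_ : (z + 1)%N%:Z - 1 = z%:Z); last by lia.
by rewrite addn0 /= mulrA -pmulrn [_ * g _ _ _]mulrC.
Qed.

Lemma sum3_du f g (i j k : nat) :
  sum3 (i + j + k + 2) (fun x y z : int =>
    (k%:Z - z)%:~R * fps_coefz g (x - 1) (y - 1) (z + 1)
    * fps_coefz f (i%:Z - x + 1) (j%:Z - y + 1) (k%:Z - z)) =
  (fps_du f * fps_ge2 g)%FPS i j k.
Proof.
(* The third index of [g] is l + 1, the bound variable itself, so only the first two variables are
   shifted. *)
apply: (@sum3_shift 1 1 0); try lia.
  move=> x y z out; case: (eqVneq z k.+1) => [->|ne].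
    by rewrite (_ : k%:Z - _ = 0) ?mul0r //; lia.
  case: (boolP ((x < 1) || (y < 1))%N) => yz.
    by rewrite (@fps_coefz_neg g) ?mulr0 ?mul0r //; lia.
  by rewrite (@fps_coefz_neg f) ?mulr0 //; lia.
move=> x y z xi yj zk; rewrite /fps_ge2 /fps_du.
rewrite (_ : (3 <= _ <= _) = (2 <= x + y + z)%N); last by lia.
case: ifP => _; last by rewrite mul0r.
rewrite (_ : (z + 0)%N%:Z - 1 + 1 = z%:Z); last by lia.
rewrite (_ : k%:Z - _ = (k - z).+1%:Z); last by lia.
rewrite (_ : j%:Z - _ + 1 = (j - y)%N%:Z); last by lia.
rewrite (_ : i%:Z - _ + 1 = (i - x)%N%:Z); last by lia.
rewrite (_ : (x + 1)%N%:Z - 1 = x%:Z); last by lia.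
rewrite (_ : (y + 1)%N%:Z - 1 = y%:Z); last by lia.
by rewrite /= mulrA -pmulrn [_ * g _ _ _]mulrC.
Qed.

Lemma fps_z_mul_zw (p : nat -> K) i j k :
  (fps_z * fps_zw p)%FPS i j k =
  if [&& i == j.+1, (0 < j)%N & k == 0%N] then p j else 0.
Proof.
rewrite fps_monomial_mul /fps_zw /= !subn0 andbT subn1.
case: i => [|i] //=; rewrite eqSS [j == i]eq_sym.
by case: eqP => [->|_] //=; rewrite andbF.
Qed.

End SeriesLemmas.

(** * The homological equation and its solution by degree *)

Section Recursion.
Variables (R : realType) (d : R) (a b e : fps3 R[i]).
Implicit Types (f : fps3 R[i]) (p : nat -> R[i]) (i j k n m : nat).

Definition nonlin f : fps3 R[i] :=
  (fps_dz f * fps_ge2 a - fps_dw f * fps_ge2 (fun i j k => b j i k)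
   + fps_du f * fps_ge2 e)%FPS.

Lemma nonlin_sum3 f i j k :
  nonlin f i j k = sum3 (i + j + k + 2) (fun x y z : int =>
    ((i%:Z - x + 1)%:~R * fps_coefz a x (y - 1) z
     - (j%:Z - y + 1)%:~R * fps_coefz b y (x - 1) z
     + (k%:Z - z)%:~R * fps_coefz e (x - 1) (y - 1) (z + 1))
    * fps_coefz f (i%:Z - x + 1) (j%:Z - y + 1) (k%:Z - z)).
Proof.
rewrite /nonlin /fps_add /fps_opp -sum3_dz -sum3_dw -sum3_du -sum3N -!sum3D.
by apply: eq_sum3 => x y z /=; rewrite !mulrDl mulNr.
Qed.

(** Differentiation costs one degree and the factor of order at least 2 gains two, so only strictly
    lower degrees enter. This makes the recursion well founded. *)
Lemma nonlin_local f g i j k :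
    (forall i' j' k', (i' + j' + k' < i + j + k)%N ->
      f i' j' k' = g i' j' k') ->
  nonlin f i j k = nonlin g i j k.
Proof.
move=> fg; rewrite /nonlin /fps_add /fps_opp; congr (_ - _ + _);
  apply: fps_mul_ge2_local => i' j' k' lt;
  by rewrite /fps_dz /fps_dw /fps_du fg //; lia.
Qed.

(** Minus the eigenvalue on z^i w^j u^k of the linear part of df/dT - f. *)
Definition divisor i j k : R[i] :=
  1 + j%:R - i%:R - 'i%C * d%:C%C * k%:R.

Definition resonant i j k : bool := (i == j.+1) && (k == 0%N).

Lemma divisor_resonant j : divisor j.+1 j 0 = 0.
Proof. by rewrite /divisor mulr0 subr0 nat1r subrr. Qed.

Lemma divisor_neq0 i j k : d != 0 -> ~~ resonant i j k -> divisor i j k != 0.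
Proof.
move=> d0; apply: contraNneq => /eqP.
(* As d is real, the real and imaginary parts separate: one forces i = j + 1, the other k = 0. *)
have -> : divisor i j k = Complex (1 + j%:R - i%:R) (- (d * k%:R)).
  rewrite /divisor -!(rmorph_nat (real_complex R)) /=.
  by simpc.
rewrite eq_complex /= oppr_eq0 mulf_eq0 (negPf d0) /= pnatr_eq0.
rewrite /resonant subr_eq0 addrC natr1 eqr_nat.
by case/andP => /eqP-> ->; rewrite eqxx.
Qed.

Lemma homological_coef f i j k :
  (derivT a b d e f - f)%FPS i j k =
  nonlin f i j k - divisor i j k * f i j k.
Proof.
rewrite /derivT /fieldZ /fieldW /fieldU /nonlin /divisor.
rewrite /fps_add /fps_opp.
rewrite !fps_mulDr fps_mulZr fps_dz_mul_z fps_dw_mul_w fps_du_mul_u.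
ring.
Qed.

(** The degree test comes first because (1, 0, 0) is resonant, yet its coefficient must be 1. *)
Definition step f : fps3 R[i] := fun i j k =>
  if (i + j + k < 2)%N then fps_z i j k
  else if resonant i j k then 0 else nonlin f i j k / divisor i j k.

Lemma step_local f g i j k :
    (forall i' j' k', (i' + j' + k' < i + j + k)%N ->
      f i' j' k' = g i' j' k') ->
  step f i j k = step g i j k.
Proof. by move=> fg; rewrite /step (nonlin_local fg). Qed.

Definition stepfix f := forall i j k, f i j k = step f i j k.

Lemma stepfix_unique f g : stepfix f -> stepfix g ->
  forall i j k, f i j k = g i j k.
Proof.
move=> ff gg i j k; have [n] := ubnP (i + j + k).
elim: n i j k => // n IHn i j k lt_n.
rewrite ff gg; apply: step_local => i' j' k' lt'.
by apply: IHn; lia.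
Qed.

(** Picard iteration: each [step] settles one more total degree, so the n-th iterate is final in
    degrees below n. [solution] reads each coefficient off an iterate where it is settled. *)
Definition approx n : fps3 R[i] := iter n step (fun _ _ _ => 0).
Definition solution : fps3 R[i] := fun i j k => approx (i + j + k).+1 i j k.

Lemma approx_stable n m i j k : (i + j + k < n)%N -> (i + j + k < m)%N ->
  approx n i j k = approx m i j k.
Proof.
elim: n m i j k => // n IHn [//|m] i j k lt_n lt_m.
by rewrite /approx !iterS; apply: step_local => i' j' k' lt'; apply: IHn; lia.
Qed.

Lemma stepfix_solution : stepfix solution.
Proof.
move=> i j k; rewrite {1}/solution /approx iterS; apply: step_local.
by move=> i' j' k' lt'; apply: approx_stable.
Qed.

(** The nonresonant equations and the normalization amount to the fixed-point equation; the resonant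
    ones of degree at least 2 only define p. *)
Lemma is_solutionP f p : d != 0 ->
  is_solution a b d e f p <->
  stepfix f /\ (forall m, (0 < m)%N -> p m = nonlin f m.+1 m 0).
Proof.
move=> d0; split=> [[[f0 fz fw fu fres] eq_f]|[ff pf]].
  have {}eq_f i j k : nonlin f i j k - divisor i j k * f i j k =
      if [&& i == j.+1, (0 < j)%N & k == 0%N] then p j else 0.
    by rewrite -homological_coef eq_f fps_z_mul_zw.
  split=> [i j k|m m0]; last first.
    have := eq_f m.+1 m 0%N.
    by rewrite divisor_resonant mul0r subr0 eqxx m0 => ->.
  rewrite /step; case: ifP => [lt2|ge2].
    by case: i j k lt2 {eq_f} => [|[|i]] [|[|j]] [|[|k]] //= _;
      rewrite ?f0 ?fz ?fw ?fu.
  (* In degree at least 2 a resonant index has j > 0, so the normalization applies. *)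
  case: ifP => [/andP[/eqP Ei /eqP Ek]|nres].
    by rewrite Ei Ek fres //; lia.
  have := eq_f i j k; rewrite andbCA -/(resonant i j k) nres andbF.
  move/subr0_eq => ->; rewrite mulrAC divff ?mul1r //.
  by rewrite divisor_neq0 ?nres.
split.
  split=> [||||k k0]; rewrite ff /step //.
  by rewrite /resonant !eqxx ifF //; lia.
move=> i j k; rewrite homological_coef fps_z_mul_zw.
(* Below degree 2 the nonlinear part vanishes and the only nonzero coefficient of [f] sits at (1, 0,
   0), where the divisor is 0. *)
have [lt2|ge2] := ltnP (i + j + k) 2.
  rewrite ifF; last by lia.
  rewrite /nonlin /fps_add /fps_opp !fps_mul_ge2_low // subr0 addr0 sub0r.
  apply/eqP; rewrite oppr_eq0; apply/eqP.
  rewrite ff /step lt2 /fps_z /fps_monomial; case: ifP => [|_]; last exact: mulr0.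
  by case/and3P => /eqP-> /eqP-> /eqP->; rewrite divisor_resonant mul0r.
case: (boolP (resonant i j k)) => [/andP[/eqP Ei /eqP Ek]|nres].
  have j0 : (0 < j)%N by lia.
  by rewrite Ei Ek !eqxx j0 /= divisor_resonant mul0r subr0 pf.
rewrite andbCA -/(resonant i j k) (negPf nres) andbF.
rewrite ff /step ltnNge ge2 (negPf nres) /=.
by rewrite mulrCA divff ?mulr1 ?subrr // divisor_neq0.
Qed.

End Recursion.

Theorem theorem3p1 (R : realType) (d : R) (hd : d != 0)
    (a b e : fps3 R[i]) :
  exists (c : fps3 R[i]) (p : nat -> R[i]),
    [/\ is_solution a b d e c p,
        (forall (c' : fps3 R[i]) (p' : nat -> R[i]),
           is_solution a b d e c' p' ->
           (forall i j k : nat, c' i j k = c i j k) /\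
           (forall m : nat, (1 <= m)%N -> p' m = p m)),
        (forall al be ga : nat,
           (2 <= al + be + ga)%N ->
           al <> be.+1 \/ (al = be.+1 /\ ga <> 0%N) ->
           c al be ga =
             1 / (1 + be%:R - al%:R - 'i%C * d%:C%C * ga%:R) *
             sum3 (al + be + ga + 2) (fun k j l : int =>
               ((al%:Z - k + 1)%:~R * fps_coefz a k (j - 1) l
                - (be%:Z - j + 1)%:~R * fps_coefz b j (k - 1) l
                + (ga%:Z - l)%:~R * fps_coefz e (k - 1) (j - 1) (l + 1))
               * fps_coefz c (al%:Z - k + 1) (be%:Z - j + 1) (ga%:Z - l)))
      & (forall m : nat, (1 <= m)%N ->
           p m =
             sum3 (2 * m + 3) (fun k j l : int =>
               ((m%:Z - k + 2)%:~R * fps_coefz a k (j - 1) l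
                - (m%:Z - j + 1)%:~R * fps_coefz b j (k - 1) l
                - l%:~R * fps_coefz e (k - 1) (j - 1) (l + 1))
               * fps_coefz c (m%:Z - k + 2) (m%:Z - j + 1) (- l)))].
Proof.
pose c := solution d a b e.
have cfix : stepfix d a b e c by exact: stepfix_solution.
exists c, (fun m => nonlin a b e c m.+1 m 0); split.
- by apply/is_solutionP.
- move=> c' p' /(is_solutionP _ _ _ _ _ hd)[c'fix p'E].
  (* The series agree coefficientwise, and by locality the values of [nonlin] that give p then agree
     too. *)
  have cc' := stepfix_unique c'fix cfix.
  by split=> // m m0; rewrite p'E //; apply: nonlin_local => *; exact: cc'.
- move=> i j k ge2 nres; rewrite -nonlin_sum3 {1}cfix /step ltnNge ge2 /=.
  rewrite ifF; first by rewrite mul1r mulrC.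
  by apply/negP => /andP[/eqP Ei /eqP Ek]; case: nres => [|[]].
(* The same triple sum at the resonant index (m + 1, m, 0), where the factor in front of [e] becomes
   0 - l. *)
- move=> m m0; rewrite nonlin_sum3 (_ : m.+1 + m + 0 + 2 = 2 * m + 3)%N; last lia.
  apply: eq_sum3 => x y z.
  by rewrite (_ : m.+1%:Z - x + 1 = m%:Z - x + 2) ?sub0r ?rmorphN ?mulNr //; lia.
Qed.
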